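(* Let $I:C^2_b(\mathbb{R}^d)\to C^0_b(\mathbb{R}^d)$ be Lipschitz continuous and satisfy the Global Comparison Property. Then for each $x\in\mathbb{R}^d$ there exists a family $\mathcal{K}(I)_x$ of linear functionals on $C^2_b(\mathbb{R}^d)\cap C^2(x)$, depending on $I$ and $x$, such that for all $u\in C^2_b(\mathbb{R}^d)\cap C^2(x)$ $$I(u,x)=\min_{v\in C^2_b(\mathbb{R}^d)}\ \max_{L\in\mathcal{K}(I)_x}\{I(v,x)+L(u-v)\}.$$ Each $L\in\mathcal{K}(I)_x$ has the form $$L(u)=\operatorname{tr}(A_xD^2u(x))+B_x\cdot\nabla u(x)+C_xu(x)+\int_{\mathbb{R}^d}\big(u(x+y)-u(x)-\mathbf{1}_{B_1(0)}(y)\,\nabla u(x)\cdot y\big)\,\mu_x(dy),$$ where $A_x$ is a symmetric positive semidefinite $d\times d$ matrix, $B_x\in\mathbb{R}^d$, $C_x\in\mathbb{R}$, and $\mu_x$ is a nonnegative Borel measure on $\mathbb{R}^d\setminus\{0\}$. Moreover, for some universal constant $C$ (independent of $x$, $L$ and $I$), for all $x$ and all $L\in\mathcal{K}(I)_x$, $$|A_x|+|B_x|+|C_x|+\int_{\mathbb{R}^d}\min\{1,|y|^2\}\,\mu_x(dy)\le C\,\|I\|_{\mathrm{Lip},C^2_b\to C^0_b}.$$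
   Context: $C^0_b(\mathbb{R}^d)$ is the space of bounded continuous functions with the sup norm; $C^2_b(\mathbb{R}^d)$ is the space of twice (continuously) differentiable functions $u$ with $u,\nabla u,D^2u$ bounded, with its usual norm. $I(u,x)$ denotes the value at $x$ of the function $I(u)$. $I$ is Lipschitz if $\|I(u)-I(v)\|_{L^\infty}\le \Lambda\|u-v\|_{C^2}$ for some $\Lambda$ and all $u,v$; $\|I\|_{\mathrm{Lip},C^2_b\to C^0_b}$ denotes the Lipschitz constant. Global Comparison Property (GCP): whenever $u\le v$ in $\mathbb{R}^d$ and $u(x)=v(x)$ for some $x$, then $I(u,x)\le I(v,x)$. Pointwise $C^2$: $u\in C^2(x)$ means there are a vector $\nabla u(x)$ and a symmetric matrix $D^2u(x)$ with $|u(y)-u(x)-\nabla u(x)\cdot(y-x)-\frac12(y-x)\cdot(D^2u(x)(y-x))|\le o(|y-x|^2)$ as $y\to x$. The constants $A_x,B_x,C_x,\mu_x$ depend on the individual functional $L$ and on $x$.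
   Formalization: The inner max over L is proved as a finite supremum, attained at some minimising v but not claimed for every v; with max for all v the claim is false, e.g. for I(u,x) = limsup of u(y) as |y| tends to infinity, minus u(x). *)

(* Defs.v *)
From HB Require Import structures.
From mathcomp Require Import all_boot all_order all_algebra.
From mathcomp Require Import all_classical all_reals all_analysis.

Set Implicit Arguments.
Unset Strict Implicit.
Unset Printing Implicit Defensive.

Import Order.TTheory GRing.Theory Num.Theory.
Import numFieldNormedType.Exports.

Local Open Scope classical_set_scope.
Local Open Scope ring_scope.

Section Defs.
Context {R : realType} {d : nat}.

(* The library norm on row vectors and matrices is the sup norm; it is only
   used for the topology. |.| is the Euclidean norm below. *)
Notation E := 'rV[R]_d.

Definition dotp (p q : E) : R := \sum_(i < d) p 0 i * q 0 i.

Definition enorm (p : E) : R := Num.sqrt (dotp p p).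

Definition mnorm (M : 'M[R]_d) : R :=
  Num.sqrt (\sum_(i < d) \sum_(j < d) M i j ^+ 2).

Definition quad (M : 'M[R]_d) (p : E) : R := dotp p (p *m M^T).

Definition psd (M : 'M[R]_d) : Prop := M^T = M /\ forall p : E, 0 <= quad M p.

Definition partial (i : 'I_d) (u : E -> R) : E -> R :=
  fun x => 'D_(delta_mx 0 i) u x.

Definition grad (u : E -> R) (x : E) : E := \row_i partial i u x.

Definition hess (u : E -> R) (x : E) : 'M[R]_d :=
  \matrix_(i, j) partial i (partial j u) x.

Definition bounded_by_some (g : E -> R) : Prop :=
  exists M : R, forall x, `|g x| <= M.

Definition C0b (f : E -> R) : Prop := continuous f /\ bounded_by_some f.

Definition C2 (u : E -> R) : Prop :=
  [/\ forall x, differentiable u x,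
      forall i x, differentiable (partial i u) x &
      forall i j, continuous (partial i (partial j u))].

Definition C2b (u : E -> R) : Prop :=
  [/\ C2 u,
      bounded_by_some u,
      bounded_by_some (fun x => enorm (grad u x)) &
      bounded_by_some (fun x => mnorm (hess u x))].

Definition supnorm (f : E -> R) : R := sup (range (fun x => `|f x|)).

Definition C2norm (u : E -> R) : R :=
  supnorm u + supnorm (fun x => enorm (grad u x))
            + supnorm (fun x => mnorm (hess u x)).

(* C^2(x). For u in C2b, Taylor's formula shows that p and M are necessarily
   grad u x and hess u x. *)
Definition C2_at (u : E -> R) (x : E) : Prop :=
  exists (p : E) (M : 'M[R]_d), M^T = M /\
    forall e : R, 0 < e -> \forall y \near x,
      `|u y - u x - dotp p (y - x) - 2^-1 * quad M (y - x)|
        <= e * enorm (y - x) ^+ 2.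

Definition C2b_C2_at (x : E) : set (E -> R) := [set u | C2b u /\ C2_at u x].

(* Operators on C^2_b and functionals on C^2_b `&` C^2(x) are represented by
   total maps on all functions; only their values on these subspaces matter. *)
Definition operator := (E -> R) -> (E -> R).
Definition functional := (E -> R) -> R.

Definition linear_on (D : set (E -> R)) (L : functional) : Prop :=
  forall (a : R) (u v : E -> R), D u -> D v ->
    L (fun z => a * u z + v z) = a * L u + L v.

Definition maps_C2b_C0b (I : operator) : Prop :=
  forall u, C2b u -> C0b (I u).

Definition lipschitz_bound (I : operator) (Lambda : R) : Prop :=
  0 <= Lambda /\
  forall u v, C2b u -> C2b v ->
    supnorm (I u \- I v) <= Lambda * C2norm (u \- v).

Definition lipschitz_C2b (I : operator) : Prop :=
  exists Lambda, lipschitz_bound I Lambda.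

Definition lip_const (I : operator) : R := inf [set Lambda | lipschitz_bound I Lambda].

Definition GCP (I : operator) : Prop :=
  forall u v, C2b u -> C2b v -> (forall y, u y <= v y) ->
    forall x, u x = v x -> I u x <= I v x.

Definition borelE : measurableType _ := g_sigma_algebraType (@open E).

Definition levy_integrand (u : E -> R) (x y : E) : R :=
  u (x + y) - u x - \1_[set z : E | enorm z < 1] y * dotp (grad u x) y.

Definition levy (A : 'M[R]_d) (B : E) (c : R)
    (mu : {measure set borelE -> \bar R}) (x : E) : functional := fun u =>
  \tr (A *m hess u x) + dotp B (grad u x) + c * u x
  + Rintegral mu setT (levy_integrand u x).

(* A measure on R^d \ {0} is a measure on R^d without mass at 0. Finiteness of
   the last integral makes levy_integrand u x mu-integrable for u in C2b. *)
Definition levy_form (kappa : R) (x : E) (L : functional) : Prop :=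
  exists (A : 'M[R]_d) (B : E) (c : R) (mu : {measure set borelE -> \bar R}),
    [/\ psd A,
        mu [set (0 : E)] = 0%E,
        forall u, C2b_C2_at x u -> L u = levy A B c mu x u &
        ((mnorm A + enorm B + `|c|)%:E
          + \int[mu]_y (Num.min 1 (enorm y ^+ 2))%:E <= kappa%:E)%E].

Definition is_max (S : set R) (m : R) : Prop := S m /\ ubound S m.
Definition is_min (S : set R) (m : R) : Prop := S m /\ lbound S m.

Definition minmax_values (I : operator) (K : set functional) (x : E)
    (u v : E -> R) : set R := [set I v x + L (u \- v) | L in K].

(* m = min_(v in C2b) max_(L in K) (I v x + L (u - v)): the outer minimum is
   attained, at some v whose inner supremum is a maximum. At the other v the
   inner max is a (finite) supremum: it cannot be required to be attained
   there, because mass of the measures may escape to infinity. For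
   I u x = limsup_(|y| -> oo) u y - u x, James's theorem excludes any family K
   of functionals as in levy_form all of whose suprema are maxima. *)
Definition is_minmax (I : operator) (K : set functional) (x : E)
    (u : E -> R) (m : R) : Prop :=
  [/\ forall v, C2b v -> has_sup (minmax_values I K x u v),
      is_min [set sup (minmax_values I K x u v) | v in C2b] m &
      exists2 v, C2b v & is_max (minmax_values I K x u v) m].

End Defs.

Arguments operator : clear implicits.
Arguments functional : clear implicits.

(* Main.v *)
(* The minimum is attained at v = u, so the point is the inequality
   I(u,x) - I(v,x) <= sup_L L(w) for w = u - v. Let K(I)_x consist of the
   operators with A = 0 and mu a multiple of a Dirac mass, subject to the size
   bound kappa. If T is the supremum over these of L(w) and s = T / kappa, then
   |w(x)|, the |partial_k w(x)| and the jump terms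
   (w(x+y) - w(x) - 1_{|y|<1} grad w(x) . y) / min(1, |y|^2) are all <= s.
   Hence an explicit rational function phi with C^2 norm at most C s lies above
   w and agrees with it at x, and the GCP and the Lipschitz bound give
   I(u,x) <= I(v + phi,x) <= I(v,x) + C s Lip(I) = I(v,x) + T. *)
Require Import Defs.
From HB Require Import structures.
From mathcomp Require Import all_boot all_order all_algebra.
From mathcomp Require Import all_classical all_reals all_analysis.
From mathcomp Require Import measurable_realfun.
From mathcomp Require Import ring lra.

Set Implicit Arguments.
Unset Strict Implicit.
Unset Printing Implicit Defensive.

Import Order.TTheory GRing.Theory Num.Theory.
Import numFieldNormedType.Exports.

Local Open Scope classical_set_scope.
Local Open Scope ring_scope.

(** * Euclidean norm of vectors and Frobenius norm of matrices, compared with the entries *)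

Section EuclideanNorm.
Context {R : realType} {d : nat}.
Implicit Types p q : 'rV[R]_d.

Lemma dotp_ge0 p : 0 <= dotp p p.
Proof. by apply: sumr_ge0 => i _; rewrite -expr2 sqr_ge0. Qed.

Lemma enorm_ge0 p : 0 <= enorm p.
Proof. exact: sqrtr_ge0. Qed.

Lemma enorm_sqr p : enorm p ^+ 2 = dotp p p.
Proof. by rewrite sqr_sqrtr ?dotp_ge0. Qed.

Lemma coord_le_enorm p k : `|p 0 k| <= enorm p.
Proof.
rewrite -(@ler_pXn2r _ 2%N) ?nnegrE ?enorm_ge0 ?normr_ge0 //.
rewrite enorm_sqr real_normK ?num_real // /dotp (bigD1 k) //= expr2 lerDl.
by apply: sumr_ge0 => i _; rewrite -expr2 sqr_ge0.
Qed.

Lemma enorm_eq0 p : (enorm p == 0) = (p == 0).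
Proof.
apply/eqP/eqP => [p0|->]; last first.
  by rewrite /enorm /dotp big1 ?sqrtr0 // => i _; rewrite mxE mul0r.
apply/rowP => k; rewrite mxE; apply/eqP; rewrite -normr_le0 -p0.
exact: coord_le_enorm.
Qed.

Lemma enorm_gt0 p : p != 0 -> 0 < enorm p.
Proof. by move=> p0; rewrite lt_neqAle enorm_ge0 eq_sym enorm_eq0 p0. Qed.

(** The sharp factor is sqrt d; since d <= d^2 for every natural d, the factor d also works, and it
    is the one that [mnorm_le] gives for matrices. *)
Lemma enorm_le (M : R) p : 0 <= M -> (forall k, `|p 0 k| <= M) ->
  enorm p <= d%:R * M.
Proof.
move=> M0 pM; rewrite -(@ler_pXn2r _ 2%N) ?nnegrE ?enorm_ge0 ?mulr_ge0 //.
rewrite enorm_sqr.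
apply: (@le_trans _ _ (\sum_(i < d) M ^+ 2)).
  apply: ler_sum => i _; rewrite -expr2 -[p 0 i ^+ 2]real_normK ?num_real //.
  by rewrite ler_pXn2r ?nnegrE ?pM.
rewrite sumr_const card_ord -[leLHS]mulr_natl exprMn ler_wpM2r ?sqr_ge0 //.
by rewrite -natrX ler_nat; case: (d) => // n; rewrite expnS expn1 leq_pmulr.
Qed.

Lemma mnorm_le (M : R) (A : 'M[R]_d) : 0 <= M -> (forall i j, `|A i j| <= M) ->
  mnorm A <= d%:R * M.
Proof.
move=> M0 AM; rewrite -(@ler_pXn2r _ 2%N) ?nnegrE ?sqrtr_ge0 ?mulr_ge0 //.
rewrite sqr_sqrtr; last first.
  by apply: sumr_ge0 => i _; apply: sumr_ge0 => j _; rewrite sqr_ge0.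
have -> : (d%:R * M) ^+ 2 = \sum_(i < d) \sum_(j < d) M ^+ 2.
  by rewrite !sumr_const !card_ord -mulrnA -[RHS]mulr_natl natrM exprMn expr2.
apply: ler_sum => i _; apply: ler_sum => j _.
rewrite -[A i j ^+ 2]real_normK ?num_real //.
by rewrite ler_pXn2r ?nnegrE ?AM.
Qed.

Lemma entry_le_mnorm (A : 'M[R]_d) i j : `|A i j| <= mnorm A.
Proof.
rewrite -(@ler_pXn2r _ 2%N) ?nnegrE ?sqrtr_ge0 ?normr_ge0 //.
rewrite sqr_sqrtr ?real_normK ?num_real //; last first.
  by apply: sumr_ge0 => k _; apply: sumr_ge0 => l _; rewrite sqr_ge0.
rewrite (bigD1 i) //= (bigD1 j) //= -addrA lerDl addr_ge0 //.
  by apply: sumr_ge0 => k _; rewrite sqr_ge0.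
by apply: sumr_ge0 => k _; apply: sumr_ge0 => l _; rewrite sqr_ge0.
Qed.

Lemma dotp_bound (M : R) p q : (forall k, `|p 0 k| <= M) ->
  `|dotp p q| <= d%:R * M * enorm q.
Proof.
move=> pM; apply: le_trans (ler_norm_sum _ _ _) _.
apply: (@le_trans _ _ (\sum_(i < d) M * enorm q)).
  by apply: ler_sum => i _; rewrite normrM ler_pM ?coord_le_enorm.
by rewrite sumr_const card_ord -[leLHS]mulr_natl mulrA.
Qed.

Lemma dotp_linearr (a : R) p q r :
  dotp p (a *: q + r) = a * dotp p q + dotp p r.
Proof.
rewrite /dotp mulr_sumr -big_split /=; apply: eq_bigr => i _.
by rewrite !mxE; ring.
Qed.

Lemma dotpC p q : dotp p q = dotp q p.
Proof. by apply: eq_bigr => i _; rewrite mulrC. Qed.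

Lemma enormZ (a : R) p : enorm (a *: p) = `|a| * enorm p.
Proof.
rewrite /enorm /dotp -sqrtr_sqr -sqrtrM ?sqr_ge0 // mulr_sumr.
by congr Num.sqrt; apply: eq_bigr => i _; rewrite !mxE; ring.
Qed.

Lemma enorm_delta k : enorm (delta_mx 0 k : 'rV[R]_d) = 1.
Proof.
rewrite /enorm /dotp (bigD1 k) //= big1 => [|i ik].
  by rewrite !mxE !eqxx mulr1 addr0 sqrtr1.
by rewrite !mxE (negPf ik) andbF mulr0.
Qed.

Lemma dotp_delta k p : dotp (delta_mx 0 k) p = p 0 k.
Proof.
rewrite /dotp (bigD1 k) //= big1 => [|i ik].
  by rewrite !mxE !eqxx mul1r addr0.
by rewrite !mxE (negPf ik) andbF mul0r.
Qed.

End EuclideanNorm.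

(** * Rules for partial derivatives, and the mean value theorem along segments *)

Section PartialDerivatives.
Context {R : realType} {d : nat}.
Implicit Types (u v : 'rV[R]_d -> R) (i j k : 'I_d).

Lemma partial_cst i (a : R) : partial i (cst a : 'rV[R]_d -> R) = cst 0.
Proof. by apply/funext => z; exact: derive_cst. Qed.

Lemma partialD i u v : (forall z, differentiable u z) ->
  (forall z, differentiable v z) ->
  partial i (u \+ v) = partial i u \+ partial i v.
Proof.
by move=> du dv; apply/funext => z; apply: deriveD; exact: diff_derivable.
Qed.

Lemma partialZ i (a : R) u : (forall z, differentiable u z) ->
  partial i (fun z => a * u z) = (fun z => a * partial i u z).
Proof.
by move=> du; apply/funext => z; apply: deriveZ; exact: diff_derivable.
Qed.

Lemma partialM i u v : (forall z, differentiable u z) ->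
  (forall z, differentiable v z) ->
  partial i (fun z => u z * v z) =
  (fun z => u z * partial i v z + v z * partial i u z).
Proof.
by move=> du dv; apply/funext => z; apply: deriveM; exact: diff_derivable.
Qed.

Lemma partialV i u : (forall z, differentiable u z) -> (forall z, u z != 0) ->
  partial i (fun z => (u z)^-1) = (fun z => - (u z) ^- 2 * partial i u z).
Proof.
move=> du u0; apply/funext => z; apply: deriveV; first exact: u0.
exact: diff_derivable.
Qed.

Lemma partial_coord i k (x : 'rV[R]_d) :
  partial i (fun z : 'rV[R]_d => z 0 k - x 0 k) = cst (i == k)%:R.
Proof.
(* The coordinate is bundled as a linear map because [diff_lin] then identifies its differential
   with the map itself. *)
have @f : {linear 'rV[R]_d -> R}.
  by exists (fun N : 'rV[R]_d => N 0 k); do 2![eexists]; do ?[constructor];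
     rewrite ?mxE// => ? *; rewrite ?mxE//; move=> ?; rewrite !mxE.
apply/funext => z; rewrite /partial deriveE; last first.
  by apply: differentiableB => //; exact: differentiable_coord.
rewrite diffB //; last exact: differentiable_coord.
rewrite diff_cst /= subr0 (_ : (fun N : 'rV[R]_d => N 0 k) = f) //.
rewrite diff_lin; last exact: coord_continuous.
by rewrite /f /= !mxE eqxx eq_sym.
Qed.

Lemma differentiable_lincomb n (f : 'I_n -> 'rV[R]_d -> R) (p : 'I_n -> R) z :
  (forall l, differentiable (f l) z) ->
  differentiable (fun z => \sum_(l < n) p l * f l z) z.
Proof.
move=> df.
rewrite (_ : (fun z => _) = \sum_(l < n) (fun z => p l * f l z)).
  by apply: differentiable_sum => l; exact: differentiableZ.
by apply/funext => y; rewrite fct_sumE.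
Qed.

Lemma partial_lincomb i n (f : 'I_n -> 'rV[R]_d -> R) (p : 'I_n -> R) :
  (forall l z, differentiable (f l) z) ->
  partial i (fun z => \sum_(l < n) p l * f l z) =
  (fun z => \sum_(l < n) p l * partial i (f l) z).
Proof.
move=> df.
rewrite (_ : (fun z => _) = \sum_(l < n) (fun z => p l * f l z)); last first.
  by apply/funext => y; rewrite fct_sumE.
apply/funext => z; rewrite /partial derive_sum; last first.
  by move=> l; apply: diff_derivable; exact: differentiableZ.
apply: eq_bigr => l _; exact: (congr1 (@^~ z) (partialZ i (p l) (df l))).
Qed.

(** Since (h + t) y + x = h y + (t y + x), the difference quotients in t are those of u in direction
    y at t y + x; linearity of the differential then splits that directional derivative into partial
    derivatives. *)
Lemma is_derive_line u (x y : 'rV[R]_d) (t : R) :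
  (forall z, differentiable u z) ->
  is_derive t 1 (fun t => u (t *: y + x))
    (\sum_(i < d) y 0 i * partial i u (t *: y + x)).
Proof.
move=> du.
have -> : \sum_(i < d) y 0 i * partial i u (t *: y + x) =
    'D_y u (t *: y + x).
  move: (t *: y + x) => z.
  rewrite deriveE // [in RHS](row_sum_delta y) linear_sum /=.
  by apply: eq_bigr => i _; rewrite linearZ /= /partial deriveE.
have dy : derivable u (t *: y + x) y by exact: diff_derivable.
have eq : (fun h : R => h^-1 *: (u ((h *: 1 + t) *: y + x) - u (t *: y + x))) =
    (fun h : R => h^-1 *: (u (h *: y + (t *: y + x)) - u (t *: y + x))).
  by apply/funext => h; rewrite (mulr1 h : h *: (1 : R) = h) scalerDl addrA.
by apply: DeriveDef; rewrite /derivable /derive /= eq.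
Qed.

Lemma mvt_line u (x y : 'rV[R]_d) : (forall z, differentiable u z) ->
  exists2 t : R, 0 <= t <= 1 &
    u (x + y) - u x = \sum_(i < d) y 0 i * partial i u (x + t *: y).
Proof.
move=> du; pose f t := u (t *: y + x).
have df t := is_derive_line x y t du.
have [|t t01] := @MVT_segment R f _ 0 1 ler01 (fun t _ => df t).
  apply: continuous_subspaceT => t; apply: differentiable_continuous.
  by apply/derivable1_diffP; have [] := df t.
rewrite subr0 mulr1 /f scale1r scale0r add0r => uyx.
exists t; first by rewrite in_itv in t01.
by rewrite [x + y]addrC uyx; apply: eq_bigr => i _; rewrite [x + _]addrC.
Qed.

End PartialDerivatives.

(** * Entrywise bounds on a function and its derivatives up to order two *)

Section C2Bounds.
Context {R : realType} {d : nat}.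
Implicit Types (u v : 'rV[R]_d -> R) (i j k : 'I_d) (M : R).

(** An explicit form of membership in [C2b] that passes to sums and multiples without handling
    suprema; [C2norm_le] converts it to the norm at the cost of a factor 1 + 2d. *)
Definition C2_le M u := [/\ C2 u, forall x, `|u x| <= M,
  forall i x, `|partial i u x| <= M &
  forall i j x, `|partial i (partial j u) x| <= M].

Lemma C2_le_ge0 M u : C2_le M u -> 0 <= M.
Proof. by case=> _ uM _ _; apply: le_trans (uM 0). Qed.

(** Lets regularity and bounds be checked on explicit formulas [u'] and [u''] once these are
    identified with the derivatives. *)
Lemma C2_leI M u (u' : 'I_d -> 'rV[R]_d -> R)
    (u'' : 'I_d -> 'I_d -> 'rV[R]_d -> R) :
  (forall x, differentiable u x) -> (forall i, partial i u = u' i) ->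
  (forall i x, differentiable (u' i) x) ->
  (forall i j, partial i (u' j) = u'' i j) ->
  (forall i j, continuous (u'' i j)) ->
  (forall x, `|u x| <= M) -> (forall i x, `|u' i x| <= M) ->
  (forall i j x, `|u'' i j x| <= M) -> C2_le M u.
Proof.
move=> du Eu' du' Eu'' cu'' uM u'M u''M.
have E2 i j : partial i (partial j u) = u'' i j by rewrite (Eu' j) (Eu'' i j).
split=> [||i x|i j x] //; last 2 first.
- by rewrite (Eu' i).
- by rewrite (E2 i j).
split=> [//|i x|i j].
- by rewrite (Eu' i).
- by rewrite (E2 i j).
Qed.

Lemma C2_le_cst (a : R) : C2_le `|a| (cst a : 'rV[R]_d -> R).
Proof.
have dc (b : R) (x : 'rV[R]_d) : differentiable (cst b : 'rV[R]_d -> R) x by [].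
apply: (@C2_leI _ _ (fun=> cst 0) (fun _ => fun=> cst 0)) => //.
- by move=> i; exact: partial_cst.
- by move=> i j; exact: partial_cst.
- by move=> i j; exact: cst_continuous.
- by move=> i x; rewrite /cst normr0.
- by move=> i j x; rewrite /cst normr0.
Qed.

Lemma C2_leD M N u v : C2_le M u -> C2_le N v -> C2_le (M + N) (u \+ v).
Proof.
move=> [[du ddu cu] uM duM dduM] [[dv ddv cv] vN dvN ddvN].
apply: (@C2_leI _ _ (fun i => partial i u \+ partial i v)
  (fun i j => partial i (partial j u) \+ partial i (partial j v))).
- by move=> x; exact: differentiableD.
- by move=> i; exact: partialD.
- by move=> i x; exact: differentiableD.
- by move=> i j; apply: partialD; [exact: ddu|exact: ddv].
- by move=> i j x; apply: continuousD; [exact: cu|exact: cv].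
- by move=> x; apply: (le_trans (ler_normD _ _)); exact: lerD.
- by move=> i x; apply: (le_trans (ler_normD _ _)); exact: lerD.
- by move=> i j x; apply: (le_trans (ler_normD _ _)); exact: lerD.
Qed.

Lemma C2_leZ M (a : R) u : C2_le M u -> C2_le (`|a| * M) (fun z => a * u z).
Proof.
move=> [[du ddu cu] uM duM dduM].
apply: (@C2_leI _ _ (fun i z => a * partial i u z)
  (fun i j z => a * partial i (partial j u) z)).
- by move=> x; exact: differentiableZ.
- by move=> i; exact: partialZ.
- by move=> i x; exact: differentiableZ.
- by move=> i j; apply: partialZ; exact: ddu.
- by move=> i j x; apply: continuousM; [exact: cst_continuous|exact: cu].
- by move=> x; rewrite normrM ler_wpM2l.
- by move=> i x; rewrite normrM ler_wpM2l.
- by move=> i j x; rewrite normrM ler_wpM2l.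
Qed.

Lemma C2_le_trans M N u : M <= N -> C2_le M u -> C2_le N u.
Proof.
move=> MN [Cu uM duM dduM].
by split=> // *; apply: le_trans MN.
Qed.

Lemma C2_le_lincomb M N n (f : 'I_n -> 'rV[R]_d -> R) (p : 'I_n -> R) :
  (forall l, C2_le M (f l)) -> (forall l, `|p l| <= N) -> 0 <= M ->
  C2_le (n%:R * (N * M)) (fun z => \sum_(l < n) p l * f l z).
Proof.
move=> fM pN M0; elim: n => [|n IHn] in f p fM pN *.
  rewrite mul0r (_ : (fun z => _) = cst 0); last first.
    by apply/funext => z; rewrite big_ord0.
  by rewrite -[X in C2_le X](normr0 R); exact: C2_le_cst.
rewrite (_ : (fun z => _) = (fun z => p ord0 * f ord0 z) \+
    (fun z => \sum_(l < n) p (lift ord0 l) * f (lift ord0 l) z)); last first.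
  by apply/funext => z; rewrite big_ord_recl.
rewrite -natr1 addrC mulrDl mul1r; apply: C2_leD.
  by apply: C2_le_trans (C2_leZ (p ord0) (fM ord0)); rewrite ler_wpM2r.
exact: IHn.
Qed.

Lemma C2b_C2_le u : C2b u -> exists M, C2_le M u.
Proof.
move=> [Cu [M0 uM0] [M1 uM1] [M2 uM2]].
exists (Num.max M0 (Num.max M1 M2)); split=> // [x|i x|i j x].
- by rewrite le_max uM0.
- rewrite !le_max; apply/orP; right; apply/orP; left.
  apply: le_trans (le_trans (ler_norm _) (uM1 x)).
  by apply: le_trans (coord_le_enorm (grad u x) i); rewrite mxE.
- rewrite !le_max; apply/orP; right; apply/orP; right.
  apply: le_trans (le_trans (ler_norm _) (uM2 x)).
  by apply: le_trans (entry_le_mnorm (hess u x) i j); rewrite mxE.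
Qed.

Lemma C2_le_grad M u x : C2_le M u -> enorm (grad u x) <= d%:R * M.
Proof.
move=> uM; have M0 := C2_le_ge0 uM; case: uM => _ _ du _.
by apply: enorm_le => // k; rewrite mxE.
Qed.

Lemma C2_le_hess M u x : C2_le M u -> mnorm (hess u x) <= d%:R * M.
Proof.
move=> uM; have M0 := C2_le_ge0 uM; case: uM => _ _ _ ddu.
by apply: mnorm_le => // i j; rewrite mxE.
Qed.

Lemma C2_le_C2b M u : C2_le M u -> C2b u.
Proof.
move=> uM; have [Cu uM0 _ _] := uM; split=> //; first by exists M.
- exists (d%:R * M) => x; rewrite ger0_norm ?enorm_ge0 //; exact: C2_le_grad.
- exists (d%:R * M) => x; rewrite ger0_norm ?sqrtr_ge0 //; exact: C2_le_hess.
Qed.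

Lemma supnorm_le M u : (forall x, `|u x| <= M) -> supnorm u <= M.
Proof.
move=> uM; apply: ge_sup; first by exists `|u 0|, 0.
by move=> _ [x _ <-].
Qed.

Lemma norm_le_supnorm u x : bounded_by_some u -> `|u x| <= supnorm u.
Proof.
move=> [M uM]; apply: ub_le_sup; last by exists x.
by exists M => _ [y _ <-].
Qed.

Lemma C2norm_le M u : C2_le M u -> C2norm u <= (1 + 2 * d%:R) * M.
Proof.
move=> uM; have [_ uM0 _ _] := uM.
have -> : (1 + 2 * d%:R) * M = M + d%:R * M + d%:R * M by ring.
apply: lerD; first apply: lerD; apply: supnorm_le => // x.
- by rewrite ger0_norm ?enorm_ge0 //; exact: C2_le_grad.
- by rewrite ger0_norm ?sqrtr_ge0 //; exact: C2_le_hess.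
Qed.

Lemma C2bD u v : C2b u -> C2b v -> C2b (u \+ v).
Proof.
move=> /C2b_C2_le[M uM] /C2b_C2_le[N vN].
exact: C2_le_C2b (C2_leD uM vN).
Qed.

Lemma C2bB u v : C2b u -> C2b v -> C2b (u \- v).
Proof.
move=> /C2b_C2_le[M uM] /C2b_C2_le[N vN].
have -> : u \- v = u \+ (fun z => -1 * v z).
  by apply/funext => z /=; rewrite mulN1r.
exact: C2_le_C2b (C2_leD uM (C2_leZ (-1) vN)).
Qed.

Lemma C2b_differentiable u : C2b u -> forall z, differentiable u z.
Proof. by case=> -[]. Qed.

Lemma grad_linear (a : R) u v x : C2b u -> C2b v ->
  grad (fun z => a * u z + v z) x = a *: grad u x + grad v x.
Proof.
move=> /C2b_differentiable du /C2b_differentiable dv; apply/rowP => i.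
rewrite !mxE.
have := partialD i (fun z => @differentiableZ _ _ _ u a z (du z)) dv.
by move=> /(congr1 (@^~ x)) /= ->; congr (_ + _); rewrite partialZ.
Qed.

(* Two applications of the mean value theorem, so that no second order Taylor
   formula is needed. *)
Lemma taylor1 M u (x y : 'rV[R]_d) : C2_le M u ->
  `|u (x + y) - u x - dotp (grad u x) y| <= d%:R * (d%:R * M) * enorm y ^+ 2.
Proof.
move=> uM; have M0 := C2_le_ge0 uM; case: uM => -[du ddu _] _ _ dduM.
have [t /andP[t0 t1] ->] := mvt_line x y du.
have -> : \sum_(i < d) y 0 i * partial i u (x + t *: y) - dotp (grad u x) y =
    \sum_(i < d) y 0 i * (partial i u (x + t *: y) - partial i u x).
  rewrite /dotp -sumrB; apply: eq_bigr => i _.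
  by rewrite mxE mulrBr [X in _ - X]mulrC.
apply: le_trans (ler_norm_sum _ _ _) _.
apply: (@le_trans _ _ (\sum_(i < d) enorm y * (d%:R * M * enorm y)));
  last first.
  rewrite sumr_const card_ord -[leLHS]mulr_natl le_eqVlt; apply/orP; left.
  by apply/eqP; ring.
apply: ler_sum => i _; rewrite normrM ler_pM ?coord_le_enorm //.
(* The second use, on the segment from x to x + t y; the factor t <= 1 in its length is dropped. *)
have [s _ ->] := mvt_line x (t *: y) (ddu i).
rewrite (_ : \sum_(j < d) _ =
    dotp (\row_j partial j (partial i u) (x + s *: (t *: y))) (t *: y)).
  apply: le_trans (@dotp_bound _ _ M _ _ _) _ => [k|]; first by rewrite mxE.
  by rewrite enormZ ler_wpM2l ?mulr_ge0 // ger0_norm // ler_piMl ?enorm_ge0.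
by rewrite dotpC; apply: eq_bigr => j _; rewrite [X in _ = _ * X]mxE.
Qed.

End C2Bounds.

(** With the indicator turned into a boolean, a case analysis on |y| < 1 evaluates it. *)
Lemma levy_integrandE (R : realType) (d : nat) (u : 'rV[R]_d -> R)
    (x y : 'rV[R]_d) :
  levy_integrand u x y =
  u (x + y) - u x - (enorm y < 1)%R%:R * dotp (grad u x) y.
Proof.
rewrite /levy_integrand indicE.
by rewrite (_ : (y \in _) = (enorm y < 1)%R) //; apply/idP/idP; rewrite inE.
Qed.

(** * Rational bump functions and the function touching w from above *)

Section Bumps.
Context {R : realType} {d : nat}.
Context (x : 'rV[R]_d).
Implicit Types (i j k : 'I_d) (z : 'rV[R]_d).

(** A rational profile: the derivatives of [bump] and [coord_bump] are polynomials in these same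
    functions, so all bounds reduce to the two functions having absolute value at most 1. *)
Definition bump z : R := (1 + dotp (z - x) (z - x))^-1.

(** A bounded substitute for the linear coordinate, with the same value and gradient at x. *)
Definition coord_bump k z : R := (z 0 k - x 0 k) * bump z.

Let q z : R := 1 + dotp (z - x) (z - x).

Let c k z : R := z 0 k - x 0 k.

Let q_ge1 z : 1 <= q z.
Proof. by rewrite lerDl dotp_ge0. Qed.

Let q_gt0 z : 0 < q z.
Proof. exact: lt_le_trans (q_ge1 z). Qed.

(** The coefficients 1 bring the sum into the shape of [differentiable_lincomb] and
    [partial_lincomb]. *)
Let qE : q = cst 1 \+ (fun z => \sum_(k < d) 1 * (c k z * c k z)).
Proof.
apply/funext => z; congr (1 + _); apply: eq_bigr => k _.
by rewrite mul1r /c !mxE.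
Qed.

Let dc k z : differentiable (c k) z.
Proof. by apply: differentiableB => //; exact: differentiable_coord. Qed.

Let dc2 k z : differentiable (fun z => c k z * c k z) z.
Proof. exact: differentiableM. Qed.

Let dq z : differentiable q z.
Proof.
by rewrite qE; apply: differentiableD => //; exact: differentiable_lincomb.
Qed.

Let partial_q i : partial i q = fun z => 2 * c i z.
Proof.
rewrite qE partialD // => [|z]; last exact: differentiable_lincomb.
rewrite partial_cst partial_lincomb //; apply/funext => z /=.
rewrite add0r (bigD1 i) //= big1 => [|k ki].
  by rewrite addr0 mul1r partialM // partial_coord /cst eqxx /=; ring.
by rewrite mul1r partialM // partial_coord /cst eq_sym (negPf ki) /=; ring.
Qed.

Lemma bump_differentiable z : differentiable bump z.
Proof. by apply: (differentiableV (dq z)); exact: lt0r_neq0 (q_gt0 z). Qed.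

Lemma coord_bump_differentiable k z : differentiable (coord_bump k) z.
Proof. exact: (differentiableM (dc k z) (bump_differentiable z)). Qed.

Lemma partial_bump i :
  partial i bump = fun z => (- 2) * (coord_bump i z * bump z).
Proof.
have -> : bump = fun z => (q z)^-1 by [].
rewrite partialV //; last by move=> z; exact: lt0r_neq0 (q_gt0 z).
apply/funext => z; rewrite partial_q /coord_bump /bump -/(q z) /c.
by field; exact: lt0r_neq0 (q_gt0 z).
Qed.

Lemma partial_coord_bump i k : partial i (coord_bump k) =
  (fun z => (i == k)%:R * bump z) \+
  (fun z => (- 2) * (coord_bump i z * coord_bump k z)).
Proof.
rewrite (partialM i (dc k) bump_differentiable) partial_bump partial_coord.
by apply/funext => z /=; rewrite /cst /coord_bump /c; ring.
Qed.

Lemma bump_le1 z : `|bump z| <= 1.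
Proof.
by rewrite ger0_norm ?invr_ge0 ?(ltW (q_gt0 z)) // invf_le1 ?q_ge1 // q_gt0.
Qed.

Lemma coord_bump_le1 k z : `|coord_bump k z| <= 1.
Proof.
rewrite /coord_bump /bump -/(q z) normrM (@ger0_norm _ (q z)^-1); last first.
  by rewrite invr_ge0 ltW.
rewrite ler_pdivrMr ?q_gt0 // mul1r.
have := coord_le_enorm (z - x) k; rewrite !mxE => /le_trans; apply.
rewrite /q -enorm_sqr; have := enorm_ge0 (z - x).
(* From (r - 1)^2 >= 0 and r >= 0 follows r <= 2r <= 1 + r^2. *)
move: (enorm _) => r r0; have := sqr_ge0 (r - 1); lra.
Qed.

Let norm_mul_le1 (a b : R) : `|a| <= 1 -> `|b| <= 1 -> `|a * b| <= 1.
Proof. by move=> a1 b1; rewrite normrM mulr_ile1. Qed.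

Let norm_nat_le1 (b : bool) : `|b%:R : R| <= 1.
Proof. by rewrite normr_nat lern1 leq_b1. Qed.

(** The i-th partial derivative of [coord_bump k], named because it recurs in the second derivatives
    of both bumps. *)
Let D i k z := (i == k)%:R * bump z + (- 2) * (coord_bump i z * coord_bump k z).

Let dD i k z : differentiable (D i k) z.
Proof.
apply: differentiableD; apply: differentiableZ; first exact: bump_differentiable.
by apply: differentiableM; exact: coord_bump_differentiable.
Qed.

Let dhg i z : differentiable (fun z => coord_bump i z * bump z) z.
Proof.
apply: differentiableM; first exact: coord_bump_differentiable.
exact: bump_differentiable.
Qed.

Let D_le3 i k z : `|D i k z| <= 3.
Proof.
have := norm_mul_le1 (norm_nat_le1 (i == k)) (bump_le1 z).
have := norm_mul_le1 (coord_bump_le1 i z) (coord_bump_le1 k z).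
rewrite /D !ler_norml; move: (_ * _) (_ * bump z) => a b.
by move=> /andP[? ?] /andP[? ?]; apply/andP; split; lra.
Qed.

(** The first derivatives are at most 2 and the second at most 10; the value 14 is the one that
    [coord_bump] needs. *)
Lemma bump_C2_le : C2_le 14 bump.
Proof.
apply: (@C2_leI _ _ _ _ (fun i z => (- 2) * (coord_bump i z * bump z))
  (fun i j z => (- 2) * (coord_bump j z * ((- 2) * (coord_bump i z * bump z))
    + bump z * D i j z))).
- exact: bump_differentiable.
- exact: partial_bump.
- by move=> i z; exact: differentiableZ.
- move=> i j; rewrite partialZ //.
  rewrite (partialM i (coord_bump_differentiable j) bump_differentiable).
  by rewrite partial_bump partial_coord_bump.
- move=> i j z; apply: differentiable_continuous; apply: differentiableZ.
  apply: differentiableD.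
    apply: differentiableM; first exact: coord_bump_differentiable.
    exact: differentiableZ.
  by apply: differentiableM; [exact: bump_differentiable|exact: dD].
- by move=> z; apply: le_trans (bump_le1 z) _; lra.
- move=> i z; have := norm_mul_le1 (coord_bump_le1 i z) (bump_le1 z).
  rewrite !ler_norml; move: (_ * _) => a.
  by move=> /andP[? ?]; apply/andP; split; lra.
- move=> i j z.
  have := norm_mul_le1 (coord_bump_le1 j z)
    (norm_mul_le1 (coord_bump_le1 i z) (bump_le1 z)).
  have := norm_mul_le1 (norm_nat_le1 (i == j))
    (norm_mul_le1 (bump_le1 z) (bump_le1 z)).
  (* Regrouping into two products of absolute value at most 1, with coefficients -2 and 8, gives the
     bound 10. *)
  rewrite (_ : (- 2) * _ = - 2 * ((i == j)%:R * (bump z * bump z)) +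
    8 * (coord_bump j z * (coord_bump i z * bump z))); last by rewrite /D; ring.
  move: (_%:R * _) (coord_bump j z * _) => a b; rewrite !ler_norml.
  by move=> /andP[? ?] /andP[? ?]; apply/andP; split; lra.
Qed.

Lemma coord_bump_C2_le k : C2_le 14 (coord_bump k).
Proof.
apply: (@C2_leI _ _ _ _ (fun i => D i k)
  (fun i j z => (j == k)%:R * ((- 2) * (coord_bump i z * bump z)) +
     (- 2) * (coord_bump j z * D i k z + coord_bump k z * D i j z))).
- exact: coord_bump_differentiable.
- by move=> i; exact: partial_coord_bump.
- by move=> i z; exact: dD.
- move=> i j.
  have dhh z : differentiable (fun z => coord_bump j z * coord_bump k z) z.
    by apply: differentiableM; exact: coord_bump_differentiable.
  rewrite partialD; last 2 first.
  + by move=> z; apply: differentiableZ; exact: bump_differentiable.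
  + by move=> z; exact: differentiableZ.
  rewrite (partialZ _ _ bump_differentiable) (partialZ _ _ dhh) partial_bump.
  rewrite (partialM i (coord_bump_differentiable j) (coord_bump_differentiable k)).
  by rewrite !partial_coord_bump.
- move=> i j z; apply: differentiable_continuous.
  apply: differentiableD; first by do 2![apply: differentiableZ].
  apply: differentiableZ; apply: differentiableD.
    by apply: differentiableM; [exact: coord_bump_differentiable|exact: dD].
  by apply: differentiableM; [exact: coord_bump_differentiable|exact: dD].
- by move=> z; apply: le_trans (coord_bump_le1 k z) _; lra.
- by move=> i z; apply: le_trans (D_le3 i k z) _; lra.
- move=> i j z.
  have := norm_mul_le1 (norm_nat_le1 (j == k))
    (norm_mul_le1 (coord_bump_le1 i z) (bump_le1 z)).
  (* The second derivative is then at most 2 + 2 (3 + 3) = 14, the constant of the lemma. *)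
  have hD l m n : `|coord_bump l z * D m n z| <= 3.
    by rewrite normrM -[leRHS]mul1r ler_pM ?coord_bump_le1 ?D_le3.
  have := hD j i k; have := hD k i j.
  rewrite [X in `|X + _|](_ : _ =
    - 2 * ((j == k)%:R * (coord_bump i z * bump z))); last by ring.
  move: (coord_bump k z * _) (coord_bump j z * D _ _ _) (_%:R * _) => a b e.
  rewrite !ler_norml.
  by move=> /andP[? ?] /andP[? ?] /andP[? ?]; apply/andP; split; lra.
Qed.

(* The function is w(x) + K |y|^2 / (1 + |y|^2) + (grad w(x) . y) / (1 + |y|^2)
   at x + y, with K absorbing both the error |y|^2 |grad w(x) . y| / (1 + |y|^2)
   made by damping the linear term and the jump term s min(1, |y|^2). *)
Lemma touching_function (s : R) (w : 'rV[R]_d -> R) : 0 <= s ->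
  `|w x| <= s -> (forall k, `|partial k w x| <= s) ->
  (forall y, levy_integrand w x y <= s * Num.min 1 (enorm y ^+ 2)) ->
  exists phi, [/\ C2_le ((31 + 29 * d%:R) * s) phi,
    forall z, w z <= phi z & phi x = w x].
Proof.
(* The part d s pays for damping the linear term P, as |P| <= d s r with r = |y|; the part 2 s pays
   for the jump term, as min(1, r^2) (1 + r^2) <= 2 r^2. *)
move=> s0 ws pws lws; pose K := (d%:R + 2) * s.
have K0 : 0 <= K by rewrite mulr_ge0 // addr_ge0.
(* Here K |y|^2 / (1 + |y|^2) is written as K - K [bump]. *)
exists ((cst (w x + K) \+ (fun z => (- K) * bump z)) \+
  (fun z => \sum_(k < d) grad w x 0 k * coord_bump k z)); split.
- apply: C2_le_trans (C2_leD (C2_leD (C2_le_cst (w x + K))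
    (C2_leZ (- K) bump_C2_le))
    (@C2_le_lincomb _ _ 14 s d coord_bump (grad w x 0) coord_bump_C2_le _ _));
    last 2 first.
  + by move=> k; rewrite mxE.
  + by [].
  (* The three summands cost s + K, 14 K and 14 d s, and s + 15 (d + 2) s + 14 d s = (31 + 29 d)
     s. *)
  rewrite normrN (ger0_norm K0).
  have := le_trans (ler_normD (w x) K) (lerD ws (lexx _)).
  rewrite (ger0_norm K0) => wK; apply: le_trans (lerD (lerD wK (lexx _)) (lexx _)) _.
  by rewrite /K le_eqVlt; apply/orP; left; apply/eqP; ring.
- move=> z /=; pose y := z - x; pose P := dotp (grad w x) y.
  have -> : \sum_(k < d) grad w x 0 k * coord_bump k z = P * bump z.
    rewrite /P /dotp mulr_suml; apply: eq_bigr => k _.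
    by rewrite /coord_bump !mxE mulrA.
  have : `|P| <= d%:R * s * enorm y by apply: dotp_bound => k; rewrite mxE.
  have := lws y; rewrite levy_integrandE -/P /y [x + _]addrC subrK -/y.
  rewrite /bump -enorm_sqr -/y.
  have := enorm_ge0 y; set r := enorm y => r0.
  have t0 : 0 <= d%:R * s by rewrite mulr_ge0.
  rewrite /K mulrDl; set t := d%:R * s in t0 *.
  rewrite ler_norml => lw /andP[Pl Pr].
  rewrite -[leRHS](_ : w x + ((t + 2 * s) * r ^+ 2 + P) / (1 + r ^+ 2) = _); last first.
    by field; rewrite lt0r_neq0 // ltr_wpDr ?sqr_ge0.
  rewrite -lerBlDl ler_pdivlMr; last by rewrite ltr_wpDr ?sqr_ge0.
  have r2 : 0 <= r ^+ 2 by rewrite sqr_ge0.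
  (* For r < 1 the bound on w contains P, and the excess P r^2 is at most t r^2. For r >= 1 it does
     not, and P >= - t r >= - t r^2 is used instead. *)
  move: lw; have [r1|r1] := ltP r 1; rewrite ?mul1r ?mul0r ?subr0 => lw.
    rewrite min_r in lw; last by rewrite expr_le1 // ltW.
    have Pr2 : 0 <= r ^+ 2 * (t * r - P) by rewrite mulr_ge0 // subr_ge0.
    have tr2 : 0 <= t * r ^+ 2 * (1 - r) by rewrite !mulr_ge0 // subr_ge0 ltW.
    have sr2 : 0 <= s * r ^+ 2 * (1 - r ^+ 2).
      by rewrite !mulr_ge0 // subr_ge0 expr_le1 // ltW.
    apply: (@le_trans _ _ ((P + s * r ^+ 2) * (1 + r ^+ 2))).
      by rewrite ler_wpM2r ?addr_ge0 //; lra.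
    by move: (r ^+ 2) r2 Pr2 tr2 sr2 => a; lra.
  have r21 : 1 <= r ^+ 2 by rewrite exprn_ege1.
  rewrite min_l // mulr1 in lw.
  have sr2 : 0 <= s * (r ^+ 2 - 1) by rewrite mulr_ge0 // subr_ge0.
  have tr2 : 0 <= t * r * (r - 1) by rewrite !mulr_ge0 // subr_ge0.
  apply: (@le_trans _ _ (s * (1 + r ^+ 2))); first by rewrite ler_wpM2r ?addr_ge0.
  by lra.
- rewrite /= /bump /coord_bump subrr big1 => [|k _]; last first.
    by rewrite subrr mul0r mulr0.
  by rewrite /dotp big1 => [|k _]; rewrite /cst ?mxE ?mul0r //; field.
Qed.

End Bumps.

(** * Functionals of Lévy form with a single point mass *)

Section PointMass.
Context {R : realType} {d : nat}.
Implicit Types (u w : 'rV[R]_d -> R) (x y B : 'rV[R]_d).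

Definition min_sqr y : R := Num.min 1 (enorm y ^+ 2).

Lemma min_sqr_ge0 y : 0 <= min_sqr y.
Proof. by rewrite le_min ler01 sqr_ge0. Qed.

Lemma min_sqr_gt0 y : y != 0 -> 0 < min_sqr y.
Proof. by move=> y0; rewrite lt_min ltr01 exprn_gt0 // enorm_gt0. Qed.

Lemma continuous_measurable_borelE (f : 'rV[R]_d -> R) : continuous f ->
  measurable_fun setT (f : @borelE R d -> R).
Proof.
move=> /continuousP cf; apply: (measurability _ (RGenOpens.measurableE R)).
move=> _ [_ [a [b ->] <-]]; rewrite setTI; apply: sub_sigma_algebra.
exact/cf/interval_open.
Qed.

Lemma dotp_continuous (p : 'rV[R]_d) : continuous (dotp p).
Proof.
move=> z; apply: differentiable_continuous.
apply: (@differentiable_lincomb _ _ d (fun k z => z 0 k) (p 0)) => k.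
exact: differentiable_coord.
Qed.

Lemma enorm_sqr_continuous : continuous (fun y : 'rV[R]_d => enorm y ^+ 2).
Proof.
rewrite (_ : (fun y => _) = fun y => \sum_(k < d) 1 * (y 0 k * y 0 k)); last first.
  by apply/funext => y; rewrite enorm_sqr; apply: eq_bigr => k _; rewrite mul1r.
move=> z; apply: differentiable_continuous.
apply: (@differentiable_lincomb _ _ d (fun k z => z 0 k * z 0 k)) => k.
by apply: differentiableM; exact: differentiable_coord.
Qed.

Lemma levy_integrand_measurable u x : C2b u ->
  measurable_fun setT (levy_integrand u x : @borelE R d -> R).
Proof.
move=> /C2b_differentiable du.
have cu : continuous u by move=> z; exact: differentiable_continuous.
apply: measurable_funB.
  apply: continuous_measurable_borelE => z.
  apply: continuousB; last exact: cst_continuous.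
  apply: (@continuous_comp _ _ _ (fun y => x + y) u); last exact: cu.
  by apply: continuousD; [exact: cst_continuous|exact: id].
apply: measurable_funM; last first.
  exact: (continuous_measurable_borelE (@dotp_continuous (grad u x))).
apply: measurable_indic; apply: sub_sigma_algebra.
(* Through the squared norm, a polynomial, the Euclidean ball is seen to be open in the topology of
   the sup norm. *)
rewrite [X in open X](_ : _ =
    (fun y : 'rV[R]_d => enorm y ^+ 2) @^-1` [set r | r < 1]).
  apply: open_comp; last exact: open_lt.
  by move=> z _; exact: enorm_sqr_continuous.
apply/seteqP; split => z /=.
  by move=> z1; rewrite exprn_ilt1 // enorm_ge0.
by apply: contraTT; rewrite -!leNgt => z1; rewrite exprn_ege1.
Qed.

(** The rule [ge0_integral_mscale] concerns nonnegative integrands, so f is split into its positive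
    and negative parts. *)
Lemma integral_mscale_dirac (m : {nonneg R}) y (f : @borelE R d -> R) :
  measurable_fun setT f ->
  (\int[mscale m (dirac (y : @borelE R d))]_z (f z)%:E = (m%:num * f y)%:E)%E.
Proof.
move=> /measurable_EFinP mf.
rewrite integralE !ge0_integral_mscale //; last 2 first.
- exact: measurable_funeneg.
- exact: measurable_funepos.
rewrite !integral_dirac //; last 2 first.
- exact: measurable_funeneg.
- exact: measurable_funepos.
rewrite diracT !mul1e funeposE funenegE /= -!EFin_max -!EFinM -EFinB.
congr (_%:E); rewrite -mulrBr; congr (_ * _).
by rewrite !maxElt; case: ltP => ?; case: ltP => ?; lra.
Qed.

(** The operator [levy] for A = 0 and m times the Dirac mass at y, with the integral already
    evaluated. *)
Definition point_levy x B (c m : R) y : functional R d := fun u =>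
  dotp B (grad u x) + c * u x + m * levy_integrand u x y.

(** The condition on m and y keeps mass away from the origin, while functionals without jump part
    may take m = 0 and y = 0. *)
Lemma point_levy_form (kappa : R) x B (c m : R) y :
  0 <= m -> (m == 0) || (y != 0) ->
  enorm B + `|c| + m * min_sqr y <= kappa ->
  levy_form kappa x (point_levy x B c m y).
Proof.
move=> m0 my bnd.
exists 0, B, c, (mscale (NngNum m0) (dirac (y : @borelE R d))); split.
- split; first by rewrite trmx0.
  by move=> p; rewrite /quad trmx0 mulmx0 /dotp big1 // => i _; rewrite mxE mulr0.
- rewrite /= /mscale /= /dirac indicE.
  have [/eqP->|y0] := orP my; first by rewrite mul0e.
  by rewrite memNset ?mule0 //; apply/eqP.
- move=> u [uC2b _]; rewrite /levy mul0mx mxtrace0 add0r /Rintegral.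
  by rewrite integral_mscale_dirac //; exact: levy_integrand_measurable.
- have -> : mnorm (0 : 'M[R]_d) = 0.
    rewrite /mnorm big1 ?sqrtr0 // => i _; rewrite big1 // => j _.
    by rewrite mxE expr0n.
  rewrite integral_mscale_dirac ?add0r; first by rewrite -EFinD lee_fin.
  apply: measurable_minr => //.
  exact: (continuous_measurable_borelE enorm_sqr_continuous).
Qed.

Lemma levy_integrand_linear (a : R) u w x y : C2b u -> C2b w ->
  levy_integrand (fun z => a * u z + w z) x y =
  a * levy_integrand u x y + levy_integrand w x y.
Proof.
move=> uC wC; rewrite !levy_integrandE grad_linear //.
by rewrite dotpC dotp_linearr !(dotpC y); ring.
Qed.

Lemma point_levy_linear x B (c m : R) y :
  linear_on (C2b_C2_at x) (point_levy x B c m y).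
Proof.
move=> a u w [uC _] [wC _].
by rewrite /point_levy levy_integrand_linear // grad_linear // dotp_linearr; ring.
Qed.

Lemma point_levy0 x B (c m : R) y : point_levy x B c m y (cst 0) = 0.
Proof.
have g0 : grad (cst 0 : 'rV[R]_d -> R) x = 0.
  by apply/rowP => i; rewrite !mxE partial_cst.
rewrite /point_levy levy_integrandE g0 /cst /dotp.
by rewrite !big1 => [|i _|i _]; rewrite ?mxE ?mul0r ?mulr0; ring.
Qed.

(** The hypotheses of [touching_function]; the jump bound is one-sided because w is only to be
    bounded from above. *)
Definition levy_dominated (s : R) w x :=
  [/\ 0 <= s, `|w x| <= s, forall k, `|partial k w x| <= s &
      forall y, levy_integrand w x y <= s * min_sqr y].

Lemma C2b_levy_dominated w x : C2b w -> exists s, levy_dominated s w x.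
Proof.
move=> /C2b_C2_le[M wM]; have M0 := C2_le_ge0 wM.
have [_ wM0 wM1 _] := wM.
have dM0 : 0 <= d%:R * (d%:R * M) by rewrite !mulr_ge0.
(* For |y| >= 1 two values of w cost 2 M; for |y| < 1 the second summand is the constant of
   [taylor1]. *)
exists (2 * M + d%:R * (d%:R * M)); split.
- by rewrite addr_ge0 // mulr_ge0.
- by apply: le_trans (wM0 x) _; lra.
- by move=> k; apply: le_trans (wM1 k x) _; lra.
move=> y; rewrite levy_integrandE.
have r0 := enorm_ge0 y.
have [y1|y1] := ltP (enorm y) 1; rewrite ?mul1r ?mul0r ?subr0.
  rewrite /min_sqr min_r; last by rewrite expr_le1 // ltW.
  apply: le_trans (le_trans (ler_norm _) (taylor1 x y wM)) _.
  by rewrite ler_wpM2r ?sqr_ge0 //; lra.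
rewrite /min_sqr min_l ?mulr1; last by rewrite exprn_ege1.
have := wM0 x; have := wM0 (x + y); rewrite !ler_norml.
by move=> /andP[? ?] /andP[? ?]; lra.
Qed.

(** The drift contributes d s kappa, since the partial derivatives are bounded one by one; the zero
    order and jump terms contribute s kappa each. This makes the inner suprema finite. *)
Lemma point_levy_le (kappa s : R) w x B (c m : R) y : 0 <= m ->
  enorm B + `|c| + m * min_sqr y <= kappa ->
  levy_dominated s w x -> point_levy x B c m y w <= (d%:R + 2) * (s * kappa).
Proof.
move=> m0 bnd [s0 wx dwx lwx].
have my0 : 0 <= m * min_sqr y by rewrite mulr_ge0 ?min_sqr_ge0.
have B0 := enorm_ge0 B; have c0 := normr_ge0 c.
have h1 : dotp B (grad w x) <= d%:R * (s * kappa).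
  rewrite dotpC; apply: le_trans (ler_norm _) _.
  apply: le_trans (@dotp_bound _ _ s _ _ _) _ => [k|]; first by rewrite mxE.
  by rewrite -mulrA !ler_wpM2l //; lra.
have h2 : c * w x <= s * kappa.
  apply: le_trans (ler_norm _) _; rewrite normrM mulrC ler_pM //; lra.
have h3 : m * levy_integrand w x y <= s * kappa.
  apply: (@le_trans _ _ (m * (s * min_sqr y))); first by rewrite ler_wpM2l.
  by rewrite mulrCA ler_wpM2l //; lra.
by rewrite /point_levy; lra.
Qed.

End PointMass.

(** * Pointwise estimates with the optimal Lipschitz constant *)

Section LipschitzConstant.
Context {R : realType} {d : nat}.
Context (I : operator R d).
Context (I_C0b : maps_C2b_C0b I) (I_lip : lipschitz_C2b I).

Lemma lip_const_ge0 : 0 <= lip_const I.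
Proof. by apply: lb_le_inf => // Lambda []. Qed.

(** Every admissible Lipschitz bound gives the inequality; dividing by N > 0 allows passing to the
    infimum, and for N = 0 any one bound suffices. *)
Lemma lip_const_le (N : R) (u v : 'rV[R]_d -> R) (x : 'rV[R]_d) :
  C2b u -> C2b v -> 0 <= N -> C2norm (u \- v) <= N ->
  I u x - I v x <= lip_const I * N.
Proof.
move=> uC vC N0 uvN.
have bd Lambda : lipschitz_bound I Lambda -> I u x - I v x <= Lambda * N.
  move=> [L0 LI]; apply: le_trans (ler_norm _) _.
  have [_ [Mu Iu]] := I_C0b uC; have [_ [Mv Iv]] := I_C0b vC.
  (* Boundedness ensures that [supnorm] is a true supremum and dominates the value at x. *)
  have bI : bounded_by_some (I u \- I v).
    exists (Mu + Mv) => z; apply: le_trans (ler_normB _ _) _.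
    exact: lerD.
  apply: le_trans (norm_le_supnorm x bI) (le_trans (LI u v uC vC) _).
  by rewrite ler_wpM2l.
move: N0; rewrite le_eqVlt => /predU1P[N0|N0].
  have [L IL] := I_lip; have := bd L IL; rewrite -N0 !mulr0; exact.
rewrite -ler_pdivrMr //; apply: lb_le_inf => // L IL.
by rewrite ler_pdivrMr //; exact: bd.
Qed.

End LipschitzConstant.

(** * The extremal family and the min-max formula *)

Section Extremal.
Context {R : realType} {d : nat}.
Context (I : operator R d).
Context (I_C0b : maps_C2b_C0b I) (I_lip : lipschitz_C2b I) (I_gcp : GCP I).

(** The first factor comes from [C2norm_le], the second from [touching_function]. *)
Definition levy_bound : R := (1 + 2 * d%:R) * (31 + 29 * d%:R) * lip_const I.

Lemma levy_bound_ge0 : 0 <= levy_bound.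
Proof.
by rewrite mulr_ge0 ?lip_const_ge0 // mulr_ge0 // addr_ge0 // mulr_ge0.
Qed.

(* By the touching function [phi] the GCP gives [I u x <= I (v + phi) x]. *)
Lemma gcp_le (s : R) (u v : 'rV[R]_d -> R) (x : 'rV[R]_d) : C2b u -> C2b v ->
  levy_dominated s (u \- v) x -> I u x - I v x <= levy_bound * s.
Proof.
move=> uC vC [s0 wx dwx lwx].
have [phi [phiM uphi phix]] := touching_function s0 wx dwx lwx.
have phiC := C2_le_C2b phiM.
have Iuphi : I u x <= I (v \+ phi) x.
  apply: (I_gcp uC (C2bD vC phiC)) => [y|].
    by have := uphi y; rewrite /=; lra.
  by rewrite /= phix /=; lra.
apply: le_trans (lerB Iuphi (lexx _)) _.
have M0 := C2_le_ge0 phiM.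
have -> : levy_bound * s =
    lip_const I * ((1 + 2 * d%:R) * ((31 + 29 * d%:R) * s)).
  by rewrite /levy_bound; ring.
apply: (lip_const_le I_C0b I_lip x (C2bD vC phiC) vC).
  by rewrite mulr_ge0 // addr_ge0 // mulr_ge0.
rewrite (_ : _ \- _ = phi); first exact: C2norm_le.
by apply/funext => z /=; rewrite addrC addKr.
Qed.

Context (x : 'rV[R]_d).

(* Drift, zero order term and one point mass: diffusion matrices are not needed,
   as masses at points tending to x recover the second order part. *)
Definition point_levys : set (functional R d) := [set L | exists B c m y,
  [/\ 0 <= m, (m == 0) || (y != 0),
      enorm B + `|c| + m * min_sqr y <= levy_bound & L = point_levy x B c m y]].

Let enorm0 : enorm (0 : 'rV[R]_d) = 0.
Proof. by apply/eqP; rewrite enorm_eq0. Qed.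

(** This is the zero functional: it makes the family nonempty and the suprema of L w nonnegative. *)
Lemma point_levys0 : point_levys (point_levy x 0 0 0 0).
Proof.
exists 0, 0, 0, 0; split=> //; first by rewrite eqxx.
by rewrite enorm0 normr0 mul0r !addr0 levy_bound_ge0.
Qed.

(** Each bound follows by testing with a functional that spends the whole budget [levy_bound] on one
    term: the zero order term, one drift direction, or one point mass. *)
Lemma point_levys_dominated (T : R) (w : 'rV[R]_d -> R) : 0 < levy_bound ->
  (forall L, point_levys L -> L w <= T) -> levy_dominated (T / levy_bound) w x.
Proof.
move=> k0 LT; have kg := ltW k0.
have T0 : 0 <= T.
  apply: le_trans (LT _ point_levys0).
  by rewrite /point_levy /dotp big1 ?mul0r ?addr0 // => i _; rewrite mxE mul0r.
have dotp0 p : dotp (0 : 'rV[R]_d) p = 0.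
  by rewrite /dotp big1 // => i _; rewrite mxE mul0r.
(* The signs e = 1 and e = -1 together bound the absolute value. *)
have wx (e : R) : `|e| = 1 -> e * w x <= T / levy_bound.
  move=> e1; rewrite ler_pdivlMr // mulrAC.
  have := LT (point_levy x 0 (e * levy_bound) 0 0).
  rewrite /point_levy dotp0 mul0r add0r addr0; apply.
  exists 0, (e * levy_bound), 0, 0; split=> //; first by rewrite eqxx.
  by rewrite enorm0 normrM e1 mul0r mul1r ger0_norm // add0r addr0.
have dwx (e : R) k : `|e| = 1 -> e * partial k w x <= T / levy_bound.
  move=> e1; rewrite ler_pdivlMr // mulrAC.
  have LE : point_levy x ((e * levy_bound) *: delta_mx 0 k) 0 0 0 w =
      e * levy_bound * partial k w x.
    rewrite /point_levy !mul0r !addr0 dotpC -[_ *: _]addr0 dotp_linearr.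
    by rewrite (dotpC _ 0) dotp0 addr0 dotpC dotp_delta mxE.
  rewrite -LE; apply: LT; exists ((e * levy_bound) *: delta_mx 0 k), 0, 0, 0.
  split=> //; first by rewrite eqxx.
  by rewrite enormZ enorm_delta normr0 mul0r !addr0 mulr1 normrM e1 mul1r ger0_norm.
split=> [||k|y].
- by rewrite divr_ge0.
- rewrite ler_norml; have := wx 1 (normr1 _); have := wx (-1) (normrN1 _).
  by move=> ? ?; apply/andP; split; lra.
- rewrite ler_norml; have := dwx 1 k (normr1 _); have := dwx (-1) k (normrN1 _).
  by move=> ? ?; apply/andP; split; lra.
(* No mass may sit at the origin, but the jump term vanishes there. *)
have [->|y0] := eqVneq y 0.
  rewrite levy_integrandE addr0 subrr dotpC dotp0 mulr0 subr0.
  by rewrite mulr_ge0 ?min_sqr_ge0 // divr_ge0.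
have m0 := min_sqr_gt0 y0.
rewrite -ler_pdivrMr // ler_pdivlMr //.
have := LT (point_levy x 0 0 (levy_bound / min_sqr y) y).
rewrite /point_levy dotp0 mul0r !add0r.
rewrite [X in _ -> X <= _](_ : _ = levy_bound / min_sqr y * levy_integrand w x y).
  apply; exists 0, 0, (levy_bound / min_sqr y), y; split=> //.
  - by rewrite divr_ge0 // ltW.
  - by rewrite y0 orbT.
  - by rewrite enorm0 normr0 !add0r divfK // lt0r_neq0.
by ring.
Qed.

Lemma minmax_values_has_sup (u v : 'rV[R]_d -> R) : C2b u -> C2b v ->
  has_sup (minmax_values I point_levys x u v).
Proof.
move=> uC vC; split.
  exists (I v x + point_levy x 0 0 0 0 (u \- v)).
  by exists (point_levy x 0 0 0 0) => //; exact: point_levys0.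
have [s ws] := C2b_levy_dominated x (C2bB uC vC).
exists (I v x + (d%:R + 2) * (s * levy_bound)).
move=> _ [_ [B [c [m [y [m0 _ bnd ->]]]]] <-].
by rewrite lerD2l (point_levy_le m0 bnd ws).
Qed.

Lemma le_sup_minmax_values (u v : 'rV[R]_d -> R) : C2b u -> C2b v ->
  I u x <= sup (minmax_values I point_levys x u v).
Proof.
move=> uC vC; set S := minmax_values _ _ _ _ _.
have [_ ubS] := minmax_values_has_sup uC vC.
have le_sup L : point_levys L -> L (u \- v) <= sup S - I v x.
  by move=> KL; rewrite lerBrDl; apply: ub_le_sup => //; exists L.
(* If [levy_bound] is 0, then [gcp_le] with any finite s gives I(u,x) <= I(v,x), and the zero
   functional bounds the supremum below by I(v,x). *)
have := levy_bound_ge0; rewrite le_eqVlt => /predU1P[k0|k0].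
  have [s ws] := C2b_levy_dominated x (C2bB uC vC).
  have := gcp_le uC vC ws; rewrite -k0 mul0r.
  have := le_sup _ point_levys0.
  rewrite /point_levy /dotp big1 => [|i _]; last by rewrite mxE mul0r.
  by rewrite !mul0r; lra.
(* Here T is [sup S - I v x], and the factor [levy_bound] cancels in T / [levy_bound]. *)
have := gcp_le uC vC (point_levys_dominated k0 le_sup).
by rewrite mulrC divfK ?lt0r_neq0 // lerD2r.
Qed.

(** All functionals of the family vanish at the zero function, so at v = u the inner maximum is
    trivially attained; there the outer minimum is attained too. *)
Lemma minmax_values_diag (u : 'rV[R]_d -> R) :
  minmax_values I point_levys x u u = [set I u x].
Proof.
have L0 L : point_levys L -> I u x + L (u \- u) = I u x.
  move=> [B [c [m [y [_ _ _ ->]]]]].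
  rewrite (_ : u \- u = cst 0) ?point_levy0 ?addr0 //.
  by apply/funext => z; rewrite /= subrr.
apply/seteqP; split=> [_ [L KL <-]|_ ->]; first exact: L0.
by exists (point_levy x 0 0 0 0); [exact: point_levys0|exact/L0/point_levys0].
Qed.

Lemma point_levys_minmax (u : 'rV[R]_d -> R) : C2b u ->
  is_minmax I point_levys x u (I u x).
Proof.
move=> uC; split=> [v vC||]; first exact: minmax_values_has_sup.
  split; first by exists u; rewrite ?minmax_values_diag ?sup1.
  by move=> _ [v vC <-]; exact: le_sup_minmax_values.
by exists u; rewrite // minmax_values_diag; split=> // _ ->.
Qed.

End Extremal.

Theorem theorem1p9 (R : realType) (d : nat) :
  exists C : R, forall I : operator R d,
    maps_C2b_C0b I -> lipschitz_C2b I -> GCP I ->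
    forall x : 'rV[R]_d, exists K : set (functional R d),
      [/\ forall L, K L -> linear_on (C2b_C2_at x) L,
          forall u, C2b_C2_at x u -> is_minmax I K x u (I u x) &
          forall L, K L -> levy_form (C * lip_const I) x L].
Proof.
(* This constant depends on d only; times [lip_const I] it is [levy_bound I]. *)
exists ((1 + 2 * d%:R) * (31 + 29 * d%:R)) => I I_C0b I_lip I_gcp x.
exists (point_levys I x); split.
- by move=> L [B [c [m [y [_ _ _ ->]]]]]; exact: point_levy_linear.
- by move=> u [uC _]; exact: point_levys_minmax.
- by move=> L [B [c [m [y [m0 my bnd ->]]]]]; exact: point_levy_form.
Qed.
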